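(* Let $g\colon\mathbb{N}\to\mathbb{N}$ be any non-decreasing unbounded function. Then $\phi_g$ is a bijection from $\mathbb{N}^2$ to $\mathbb{N}$ (a pairing function), and $\psi_g$ is its inverse.
   Context: $\mathbb{N}$ denotes the non-negative integers. $g$ is non-decreasing if $x\le y$ implies $g(x)\le g(y)$, and unbounded if for every $y\in\mathbb{N}$ there is $x$ with $g(x)\ge y$. For unbounded $g$, define $g^+\colon\mathbb{N}\to\mathbb{N}$ by letting $g^+(y)$ be the smallest $x\in\mathbb{N}$ with $g(x)\ge y$. The step points of $g$ are the elements of the range of $g^+$, listed increasingly as $s_0<s_1<s_2<\cdots$ (there are infinitely many, and $s_0=0$). For each $k\in\mathbb{N}$ let $B_k=\{0,1,\ldots,s_{k+1}(g(s_k)+1)-1\}$. Define $\phi_g\colon\mathbb{N}^2\to\mathbb{N}$ by $\phi_g(x,y)=y\cdot g^+(y)+x$ if $y>g(x)$, and $\phi_g(x,y)=x(g(x)+1)+y$ otherwise. Define $\psi_g\colon\mathbb{N}\to\mathbb{N}^2$ as follows: for $z\in\mathbb{N}$, let $m$ be the smallest non-negative integer with $z\in B_m$; then $\psi_g(z)=\bigl(z\bmod s_m,\ \lfloor z/s_m\rfloor\bigr)$ if $z<s_m(g(s_m)+1)$, and $\psi_g(z)=\bigl(\lfloor z/(g(s_m)+1)\rfloor,\ z\bmod (g(s_m)+1)\bigr)$ otherwise. *)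

(* Defs.v *)
From mathcomp Require Import all_boot all_classical.
Set Implicit Arguments.
Unset Strict Implicit.
Unset Printing Implicit Defensive.
Local Open Scope classical_set_scope.
Local Open Scope nat_scope.

Definition nondecreasing (g : nat -> nat) : Prop :=
  forall x y, x <= y -> g x <= g y.

Definition unbounded (g : nat -> nat) : Prop := forall y, exists x, y <= g x.

Definition gplus (g : nat -> nat) (g_unb : unbounded g) (y : nat) : nat :=
  ex_minn (g_unb y).

Definition step_points (g : nat -> nat) (g_unb : unbounded g) : set nat :=
  range (gplus g_unb).

Lemma step_points_nonempty g (g_unb : unbounded g) :
  exists x, x \in step_points g_unb.
Proof. by exists (gplus g_unb 0); apply/mem_set; exists 0. Qed.

Lemma step_points_unbounded g (g_unb : unbounded g) n :
  exists x, (x \in step_points g_unb) && (n < x).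
Proof.
pose M := \max_(i < n.+1) g i.
exists (gplus g_unb M.+1); apply/andP; split.
  by apply/mem_set; exists M.+1.
rewrite /gplus; case: ex_minnP => x Mgx _; rewrite ltnNge; apply/negP => xn.
have /(leq_trans Mgx) : g x <= M.
  exact: (leq_bigmax (Ordinal (xn : x < n.+1))).
by rewrite ltnn.
Qed.

Fixpoint step g (g_unb : unbounded g) (k : nat) : nat :=
  if k is k'.+1 then ex_minn (step_points_unbounded g_unb (step g_unb k'))
  else ex_minn (step_points_nonempty g_unb).

Lemma step_lt g (g_unb : unbounded g) k : step g_unb k < step g_unb k.+1.
Proof. by rewrite /=; case: ex_minnP => x /andP[]. Qed.

Lemma range_step g (g_unb : unbounded g) :
  range (step g_unb) = step_points g_unb.
Proof.
apply/seteqP; split=> [_ [k _ <-]|x xS].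
  apply/set_mem; case: k => [|k] /=; first by case: ex_minnP.
  by case: ex_minnP => x /andP[].
have lek k : k <= step g_unb k.
  by elim: k => // k /leq_ltn_trans; apply; exact: step_lt.
have [|m xm minm] := @ex_minnP (fun k => x <= step g_unb k); first by exists x.
exists m => //; apply/eqP; rewrite eqn_leq xm andbT.
case: m minm {xm} => [|m] minm /=; case: ex_minnP => s _; apply.
  exact/mem_set.
rewrite mem_set //= ltnNge; apply/negP => /minm; by rewrite ltnn.
Qed.

Definition B g (g_unb : unbounded g) (k : nat) : set nat :=
  `I_(step g_unb k.+1 * (g (step g_unb k) + 1)).

Lemma B_cover g (g_unb : unbounded g) z : exists m, z \in B g_unb m.
Proof.
have lek k : k <= step g_unb k.
  by elim: k => // k /leq_ltn_trans; apply; exact: step_lt.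
exists z; apply/mem_set; rewrite /B /mkset addn1.
exact: leq_trans (lek z.+1) (leq_pmulr _ _).
Qed.

Definition phi g (g_unb : unbounded g) (p : nat * nat) : nat :=
  let: (x, y) := p in
  if g x < y then y * gplus g_unb y + x else x * (g x + 1) + y.

Definition psi g (g_unb : unbounded g) (z : nat) : nat * nat :=
  let m := ex_minn (B_cover g_unb z) in
  let s := step g_unb m in
  if z < s * (g s + 1) then (z %% s, z %/ s)
  else (z %/ (g s + 1), z %% (g s + 1)).

(* Main.v *)
Require Import Defs.
From mathcomp Require Import all_boot all_classical.

(** Put [s k = step k] and [G k = g (s k)]. The rectangles
    [R k = [0, s k.+1) x [0, G k]] increase to the whole quadrant, and the
    bijection fills [R k] with the values of [B k]. Passing from [R k] to
    [R k.+1] takes two stages: new rows [G k < y <= G k.+1] of length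
    [s k.+1], numbered from [s k.+1 * (G k + 1)] on, and then new columns
    [s k.+1 <= x < s k.+2] of height [G k.+1 + 1], numbered from
    [s k.+1 * (G k.+1 + 1)] on. On either stage [phi] and [psi] are a
    multiplication with addition and the matching Euclidean division. *)

Section PairingFunction.

Set Implicit Arguments.
Unset Strict Implicit.

Variable g : nat -> nat.
Hypothesis g_nondecr : nondecreasing g.
Hypothesis g_unb : unbounded g.

Local Notation s := (step g_unb).
Local Notation gp := (gplus g_unb).

(** Monotonicity makes the set of [x] with [y <= g x] upward closed, so [gp] is the lower adjoint of
    [g] in a Galois connection. *)
Lemma ltn_gplus x y : (x < gp y) = (g x < y).
Proof.
rewrite /gplus; case: ex_minnP => m ym minm; apply/idP/idP.
  by rewrite !ltnNge; apply/contraNN/minm.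
rewrite !ltnNge; apply: contraNN => /g_nondecr; exact: leq_trans.
Qed.

Lemma leq_gplus x y : (gp y <= x) = (y <= g x).
Proof. by rewrite leqNgt ltn_gplus -leqNgt. Qed.

Lemma step0 : s 0 = 0.
Proof.
rewrite /=; case: ex_minnP => m _ minm; apply/eqP; rewrite -leqn0.
by apply: minm; apply/mem_set; exists 0 => //; apply/eqP; rewrite -leqn0 leq_gplus.
Qed.

Lemma step_leq_gplus k y : s k < gp y -> s k.+1 <= gp y.
Proof.
move=> sky /=; case: ex_minnP => m _; apply; rewrite sky andbT.
by apply/mem_set; exists y.
Qed.

Lemma gplusE k y : g (s k) < y <= g (s k.+1) -> gp y = s k.+1.
Proof.
move=> /andP[ly yl]; apply/eqP.
by rewrite eqn_leq leq_gplus yl step_leq_gplus ?ltn_gplus.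
Qed.

(** If [g x] exceeded [g (s k)], then [gp (g x)] would be a step point after [s k] and at most [x],
    hence strictly between two consecutive ones. *)
Lemma g_constant k x : s k <= x < s k.+1 -> g x = g (s k).
Proof.
move=> /andP[kx xk]; apply/eqP; rewrite eqn_leq (g_nondecr kx) andbT leqNgt.
rewrite -ltn_gplus; apply/negP => /step_leq_gplus.
by rewrite leqNgt (leq_ltn_trans _ xk) // leq_gplus.
Qed.

Lemma leq_step j k : j <= k -> s j <= s k.
Proof.
by apply: (homo_leq leqnn leq_trans (f := s)) => // i; exact/ltnW/step_lt.
Qed.

Lemma leq_B_bound j k :
  j <= k -> s j.+1 * (g (s j) + 1) <= s k.+1 * (g (s k) + 1).
Proof.
move=> jk; apply: leq_mul; first exact: leq_step.
by rewrite leq_add2r; apply/g_nondecr/leq_step.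
Qed.

Lemma mem_B k z : (z \in B g_unb k) = (z < s k.+1 * (g (s k) + 1)).
Proof. by apply/idP/idP => [/set_mem|zk] //; apply/mem_set. Qed.

Lemma level_eq k z :
    (forall j, j < k -> s j.+1 * (g (s j) + 1) <= z) ->
    z < s k.+1 * (g (s k) + 1) ->
  ex_minn (B_cover g_unb z) = k.
Proof.
move=> lez zlt; case: ex_minnP => m; rewrite mem_B => zm minm.
apply/eqP; rewrite eqn_leq minm ?mem_B //= leqNgt.
by apply/negP => /lez; rewrite leqNgt zm.
Qed.

(** The index shifts: these values lie outside [B k], so their level is [k.+1], and the first branch
    of [psi] divides by [s k.+1]. *)
Lemma psi_row k z :
    s k.+1 * (g (s k) + 1) <= z < s k.+1 * (g (s k.+1) + 1) ->
  psi g_unb z = (z %% s k.+1, z %/ s k.+1).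
Proof.
move=> /andP[lez zlt]; rewrite /psi (@level_eq k.+1) ?zlt //.
  by move=> j jk; apply: leq_trans lez; apply: leq_B_bound.
by apply: leq_trans zlt _; rewrite leq_mul2r ltnW ?orbT ?step_lt.
Qed.

Lemma psi_column k z :
    s k * (g (s k) + 1) <= z < s k.+1 * (g (s k) + 1) ->
  psi g_unb z = (z %/ (g (s k) + 1), z %% (g (s k) + 1)).
Proof.
move=> /andP[lez zlt]; rewrite /psi (@level_eq k) //; first by rewrite ltnNge lez.
move=> j jk; apply: leq_trans lez; apply: leq_mul; first exact: leq_step.
by rewrite leq_add2r; apply/g_nondecr/leq_step/ltnW.
Qed.

Lemma phi_row k x y :
    x < s k.+1 -> g (s k) < y <= g (s k.+1) ->
  phi g_unb (x, y) = y * s k.+1 + x.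
Proof. by move=> xk yk; rewrite /phi -ltn_gplus (gplusE yk) xk. Qed.

Lemma phi_column k x y :
    s k <= x < s k.+1 -> y <= g (s k) ->
  phi g_unb (x, y) = x * (g (s k) + 1) + y.
Proof. by move=> xk yk; rewrite /phi (g_constant xk) ltnNge yk. Qed.

Lemma pair_row_or_column x y :
  (exists k, x < s k.+1 /\ g (s k) < y <= g (s k.+1)) \/
  (exists k, s k <= x < s k.+1 /\ y <= g (s k)).
Proof.
have [gxy|ygx] := ltnP (g x) y; [left|right].
  have : step_points g_unb (gp y) by exists y.
  (* The step point [gp y] cannot be [s 0 = 0], since [x < gp y]; so it has a predecessor [s k]. *)
  rewrite -range_step => -[[|k] _ sk].
    by move: gxy; rewrite -ltn_gplus -sk step0.
  exists k; rewrite sk ltn_gplus gxy -ltn_gplus -sk step_lt.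
  by rewrite -leq_gplus sk leqnn.
have exk : exists k, x < s k.+1.
  exists x; elim: x {ygx} => [|x /leq_ltn_trans]; last by apply; exact: step_lt.
  by apply: leq_ltn_trans (step_lt _ _).
have [k xk mink] := ex_minnP exk.
have kx : s k <= x < s k.+1.
  rewrite xk andbT; case: k mink {xk} => [|k] mink; first by rewrite step0.
  by rewrite leqNgt; apply/negP => /mink; rewrite ltnn.
by exists k; rewrite -(g_constant kx).
Qed.

Lemma value_row_or_column z :
  (exists k, s k.+1 * (g (s k) + 1) <= z < s k.+1 * (g (s k.+1) + 1)) \/
  (exists k, s k * (g (s k) + 1) <= z < s k.+1 * (g (s k) + 1)).
Proof.
have [m] := ex_minnP (B_cover g_unb z); rewrite mem_B => zm minm.
have [zlt|lez] := ltnP z (s m * (g (s m) + 1)); last by right; exists m; rewrite lez.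
(* Level 0 has no row stage: its threshold is 0 because [s 0 = 0]. At level [k.+1], minimality puts
   [z] outside [B k]. *)
left; case: m minm zm zlt => [|k] minm _ zlt; first by rewrite step0 in zlt.
exists k; rewrite zlt andbT leqNgt -mem_B.
by apply/negP => /minm; rewrite ltnn.
Qed.

Lemma phiK : cancel (phi g_unb) (psi g_unb).
Proof.
move=> [x y]; have [[k [xk yk]]|[k [xk yk]]] := pair_row_or_column x y.
  rewrite (phi_row xk yk) (@psi_row k).
    have s_gt0 := leq_ltn_trans (leq0n x) xk.
    by rewrite modnMDl modn_small // divnMDl // divn_small // addn0.
  case/andP: yk => Gy yG; rewrite !addn1; apply/andP; split.
    by rewrite mulnC; apply: leq_trans (leq_addr _ _); rewrite leq_mul2r Gy orbT.
  by rewrite mulnS addnC mulnC -addSn; apply: leq_add; rewrite // leq_mul2l yG orbT.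
have yk1 : y < g (s k) + 1 by rewrite addn1.
rewrite (phi_column xk yk) (@psi_column k).
  rewrite modnMDl modn_small // divnMDl; last by rewrite addn1.
  by rewrite divn_small // addn0.
case/andP: xk => kx xk; apply/andP; split.
  by apply: leq_trans (leq_addr _ _); rewrite leq_mul2r kx orbT.
(* As [y] is below the column height, the value stays below the start of column [x.+1]. *)
apply: (@leq_trans (x.+1 * (g (s k) + 1))); last by rewrite leq_mul2r xk orbT.
by rewrite mulSn addnC ltn_add2r.
Qed.

Lemma psiK : cancel (psi g_unb) (phi g_unb).
Proof.
move=> z; have [[k zk]|[k zk]] := value_row_or_column z.
  have s_gt0 : 0 < s k.+1 := leq_ltn_trans (leq0n _) (step_lt g_unb k).
  (* [divn_eq] reassembles [z]; it remains to check that the quotient is a row number of stage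
     [k]. *)
  rewrite (psi_row zk) (@phi_row k) -?divn_eq ?ltn_mod //.
  case/andP: zk => lez zlt; apply/andP; split.
    by rewrite leq_divRL // mulnC -[(g _).+1]addn1.
  by rewrite -ltnS ltn_divLR // mulnC -[(g _).+1]addn1.
have G_gt0 : 0 < g (s k) + 1 by rewrite addn1.
rewrite (psi_column zk) (@phi_column k) -?divn_eq //.
  by rewrite leq_divRL // ltn_divLR.
by rewrite -ltnS -[X in _ < X]addn1 ltn_mod.
Qed.

End PairingFunction.

Theorem theorem4p7 (g : nat -> nat) (g_nondecr : nondecreasing g)
    (g_unb : unbounded g) :
  bijective (phi g_unb) /\
  cancel (phi g_unb) (psi g_unb) /\ cancel (psi g_unb) (phi g_unb).
Proof.
have phiK := @phiK g g_nondecr g_unb; have psiK := @psiK g g_nondecr g_unb.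
by split; first exists (psi g_unb).
Qed.
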